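(* Let $F$ be a field, let $n\ge 1$, and let $A\in M_n(F)$. Then the following are equivalent: (1) $A=E+W$ for some idempotent matrix $E\in M_n(F)$ and some nilpotent matrix $W\in M_n(F)$ with $EW=WE$; (2) $\chi(A)=t^{s}(t-1)^{r}$ for some integers $s,r\ge 0$.
   Context: $\chi(A)=\det(tI_n-A)\in F[t]$ denotes the characteristic polynomial of $A$ in the indeterminate $t$. *)

(* Defs.v *)
From mathcomp Require Import all_boot all_order all_algebra.

Set Implicit Arguments.
Unset Strict Implicit.
Unset Printing Implicit Defensive.

Import GRing.Theory.
Local Open Scope ring_scope.

Definition idempotent_mx (F : fieldType) (n : nat) (E : 'M[F]_n) : Prop :=
  E *m E = E.

Definition nilpotent_mx (F : fieldType) (n : nat) (W : 'M[F]_n) : Prop :=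
  exists k : nat, W ^+ k = 0.

(* Main.v *)
Require Import Defs.
From mathcomp Require Import all_boot all_order all_algebra.

Set Implicit Arguments.
Unset Strict Implicit.
Unset Printing Implicit Defensive.

Import GRing.Theory.
Local Open Scope ring_scope.

(** Both conditions say that [A * A - A] is nilpotent.

    If [A = E + W] as in the first condition, then
    [A * A - A = W * (E + A - 1)], a nilpotent times something commuting with it.
    Conversely, if [(A * A - A) ^+ k = 0], then [A] is killed by the product of
    the coprime polynomials ['X^k] and [('X - 1) ^+ k]; Bezout's identity gives a
    polynomial [e] that is [0] modulo the first and [1] modulo the second, and
    [E = e(A)], [W = A - E] is the required decomposition
    ([nilpotent_idempotent_split]).

    If the characteristic polynomial is ['X^s * ('X - 1) ^+ r], then
    [A * A - A] is nilpotent by Cayley-Hamilton.  Conversely, taking determinants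
    in a factorisation over [F[t]] shows that the characteristic polynomial
    divides a power of ['X * ('X - 1)] ([char_poly_dvd_of_nilpotent]).
    A monic divisor of such a power has the form ['X^s * ('X - 1) ^+ r] by
    unique factorisation ([monic_dvd_XsubX1_exp]). *)

Lemma prod_XsubC_01 (F : fieldType) (s : seq F) :
  {subset s <= [:: 0; 1]} ->
  \prod_(c <- s) ('X - c%:P) = 'X^(count_mem 0 s) * ('X - 1) ^+ count_mem 1 s.
Proof.
elim: s => [|c s IHs] s01; first by rewrite big_nil /= !expr0 mulr1.
rewrite big_cons IHs => [|x xs]; last by apply: s01; rewrite inE xs orbT.
have := s01 c (mem_head _ _); rewrite !inE => /orP[] /eqP-> /=.
  by rewrite eqxx eq_sym oner_eq0 subr0 exprS mulrA.
by rewrite eqxx oner_eq0 /= polyC1 mulrCA -exprS.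
Qed.

(** A product of linear factors divides like a multiset: a monic divisor is the
    product over a subsequence of the roots, here [m] zeros and [m] ones. *)
Lemma monic_dvd_XsubX1_exp (F : fieldType) (p : {poly F}) (m : nat) :
  p \is monic -> p %| ('X * ('X - 1)) ^+ m ->
  exists s r : nat, p = 'X^s * ('X - 1) ^+ r.
Proof.
move=> p_monic; pose rs : seq F := nseq m 0 ++ nseq m 1.
have rs01 : {subset rs <= [:: 0; 1]}.
  by move=> x; rewrite mem_cat !mem_nseq !inE => /orP[] /andP[_ ->];
     rewrite ?orbT.
have -> : ('X * ('X - 1)) ^+ m = \prod_(c <- rs) ('X - c%:P).
  rewrite exprMn prod_XsubC_01 // !count_cat !count_nseq /= !eqxx.
  by rewrite oner_eq0 eq_sym oner_eq0 !mul0n !mul1n addn0.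
case/dvdp_prod_XsubC => b pE.
have {pE} -> : p = \prod_(c <- mask b rs) ('X - c%:P).
  by apply/eqP; rewrite -eqp_monic // monic_prod_XsubC.
by rewrite prod_XsubC_01 => [|x /mem_mask/rs01 //]; do 2!eexists.
Qed.

(** The factorisation of [p(x) - p(a)] for [p = 'X^2 - 'X].  It serves with
    [x = E + W], [a = E], and with [x = t], [a = A] over [F[t]]. *)
Lemma subr_sqr_sub_id_comm (R : pzRingType) (x a : R) :
  GRing.comm x a ->
  (x * x - x) - (a * a - a) = (x - a) * (x + a - 1).
Proof.
move=> xa; have xBa : (x - a) * (x + a) = x * x - a * a.
  by rewrite mulrBl !mulrDr xa opprD addrA addrK.
by rewrite mulrBr mulr1 xBa !opprB addrACA [in RHS]addrACA [- x + _]addrC.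
Qed.

(** Over [F[t]], [t - A] is a factor of [(t^2 - t) - (A^2 - A)], hence of
    [(t^2 - t)^k - (A^2 - A)^k], which is the scalar matrix [(t^2 - t)^k];
    take determinants. *)
Lemma char_poly_dvd_of_nilpotent (F : fieldType) (n k : nat) (A : 'M[F]_n) :
  (A * A - A) ^+ k = 0 -> char_poly A %| ('X * ('X - 1)) ^+ (k * n).
Proof.
move=> nilA; pose x : 'M[{poly F}]_n := 'X%:M; pose a := map_mx polyC A.
pose q : {poly F} := 'X * ('X - 1).
have scalC (p : {poly F}) (B : 'M_n) : GRing.comm (p%:M : 'M_n) B.
  exact/esym/scalar_mxC.
have qE : q%:M = x * x - x.
  by rewrite /q /x mulrBr mulr1 raddfB /= scalar_mxM.
have bE : a * a - a = map_mx polyC (A * A - A) by rewrite map_mxB map_mxM.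
have bk0 : (a * a - a) ^+ k = 0 by rewrite bE -rmorphXn nilA rmorph0.
have fact_qb : q%:M - (a * a - a) = (x - a) * (x + a - 1).
  by rewrite qE; apply: subr_sqr_sub_id_comm; exact: scalC.
have := subrXX_comm k (scalC q (a * a - a)).
rewrite bk0 subr0 fact_qb -mulrA -rmorphXn /= => /(congr1 determinant).
by rewrite det_scalar -exprM det_mulmx => ->; rewrite dvdp_mulIl.
Qed.

(** Lifting of an idempotent along a nil ideal, in the subalgebra generated by
    [A]: [A] is idempotent modulo nilpotents, and the lift [E] is a polynomial in
    [A], hence commutes with [A - E]. *)
Lemma nilpotent_idempotent_split (F : fieldType) (n k : nat) (A : 'M[F]_n.+1) :
  (A * A - A) ^+ k = 0 ->
  exists E W : 'M[F]_n.+1,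
    [/\ idempotent_mx E, nilpotent_mx W, comm_mx E W & A = E + W].
Proof.
move=> nilA; pose q : {poly F} := 'X * ('X - 1).
(* The exponent [k.+1] is positive even for [k = 0], so that ['X] and ['X - 1]
   divide their powers below. *)
have qA0 : horner_mx A (q ^+ k.+1) = 0.
  rewrite rmorphXn rmorphM rmorphB /= horner_mx_X rmorph1 mulrBr mulr1.
  by rewrite exprS nilA mulr0.
have cop01 i j : coprimep ('X^i : {poly F}) (('X - 1) ^+ j).
  apply: coprimep_expl; apply: coprimep_expr.
  rewrite -[X in coprimep X _]subr0 -polyC0 -polyC1 coprimep_XsubC.
  by rewrite root_XsubC oner_eq0.
have /Bezout_eq1_coprimepP[[u v] /= uv1] := cop01 k.+1 k.+1.
pose e := u * 'X^(k.+1); pose w := 'X - e.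
have eE : 1 - e = v * ('X - 1) ^+ k.+1 by rewrite -[1 in LHS]uv1 addrC addKr.
have eA0 : horner_mx A (e * (1 - e)) = 0.
  by rewrite eE /e mulrACA -exprMn rmorphM /= qA0 mulr0.
(* [w] vanishes at [0] because [e] does, and at [1] because [1 - e] does;
   so [w ^+ k.+1] is a multiple of [q ^+ k.+1], which kills [A]. *)
have q_dvd_w : q %| w.
  rewrite Gauss_dvdp ?(cop01 1 1) //; apply/andP; split.
    by rewrite /w /e exprSr mulrA dvdp_sub ?dvdp_mull.
  have -> : w = ('X - 1) + (1 - e) by rewrite /w addrA subrK.
  by rewrite eE exprSr mulrA dvdp_add ?dvdp_mull.
exists (horner_mx A e), (horner_mx A w); split.
- move/eqP: eA0; rewrite mulrBr mulr1 rmorphB (rmorphM _ e e) subr_eq0 eq_sym.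
  by move/eqP.
- exists k.+1; have /dvdpP[c ->] := q_dvd_w.
  by rewrite -rmorphXn exprMn rmorphM /= qA0 mulr0.
- exact: comm_horner_mx2.
- by rewrite -rmorphD /w addrC subrK /= horner_mx_X.
Qed.

Theorem corollary2p7 (F : fieldType) (n : nat) (hn : (1 <= n)%N) (A : 'M[F]_n) :
  (exists E W : 'M[F]_n,
     [/\ idempotent_mx E, nilpotent_mx W, comm_mx E W & A = E + W]) <->
  (exists s r : nat, char_poly A = 'X^s * ('X - 1) ^+ r).
Proof.
case: n hn A => // n _ A; split.
  case=> E [W [EE [k Wk0] EW AE]].
  apply: (@monic_dvd_XsubX1_exp _ _ (k * n.+1)); first exact: char_poly_monic.
  apply: char_poly_dvd_of_nilpotent.
  have WE : GRing.comm W E by exact/esym.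
  have AEC : GRing.comm A E by rewrite AE; exact/esym/commrD.
  have EE0 : E * E - E = 0 by apply/eqP; rewrite subr_eq0; exact/eqP.
  (* Writing [0] as [E * E - E] exhibits the factor [A - E = W]. *)
  rewrite -[A * A - A]subr0 -EE0 subr_sqr_sub_id_comm //.
  have -> : A - E = W by rewrite AE addrAC subrr add0r.
  rewrite exprMn_comm ?Wk0 ?mul0r // AE.
  by apply: commrB; [do 2!apply: commrD => // | exact: commr1].
case=> s [r charA].
apply: (@nilpotent_idempotent_split _ _ (s + r)).
have AA1 : A * A - A = horner_mx A ('X * ('X - 1)).
  by rewrite rmorphM rmorphB /= horner_mx_X rmorph1 mulrBr mulr1.
have -> : (A * A - A) ^+ (s + r)
    = horner_mx A (char_poly A * ('X^r * ('X - 1) ^+ s)).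
  rewrite AA1 -rmorphXn charA exprMn !exprD; congr (horner_mx A _).
  by rewrite [RHS]mulrACA [_ ^+ r * _]mulrC.
by rewrite rmorphM /= Cayley_Hamilton mul0r.
Qed.
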